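(* Let $q$ be a prime power, let $m,\ell$ be positive integers, and suppose that $m$ has a chain of divisors $1=m_d\mid m_{d-1}\mid\cdots\mid m_2\mid m_1=m$ with $m_i\neq m_{i-1}$ for all $1<i\le d$. Let $V=\mathbb F_{q^m}^{2\ell}$ and let $Q:V\to\mathbb F_{q^m}$ be a nonsingular elliptic quadratic form. For $1\le i\le d$ let $\mathrm{tr}_{q^m/q^{m_i}}$ be the trace from $\mathbb F_{q^m}$ to $\mathbb F_{q^{m_i}}$, let $Q_i=\mathrm{tr}_{q^m/q^{m_i}}\circ Q$, and let $\Omega_i=\{x\in V: x\neq 0,\ Q_i(x)=0\}$, so that $\Omega_1\subset\Omega_2\subset\cdots\subset\Omega_d$. Then the Cayley graphs on the additive group of $V$ generated by the sets $$\Omega_1,\ \Omega_2\setminus\Omega_1,\ \Omega_3\setminus\Omega_2,\ \ldots,\ \Omega_d\setminus\Omega_{d-1},\ (V\setminus\{0\})\setminus\Omega_d$$ form a $(d+1)$-class amorphic association scheme on $V$.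
   Context: Quadratic forms. A quadratic form on a finite-dimensional vector space $V$ over a finite field $\mathbb F$ is a function $Q:V\to\mathbb F$ with $Q(\gamma v)=\gamma^2Q(v)$ for all $\gamma\in\mathbb F$, $v\in V$, and such that $B(v_1,v_2)=Q(v_1+v_2)-Q(v_1)-Q(v_2)$ is bilinear. It is nonsingular if the only subspace $W$ with $Q$ vanishing on $W$ and $B(w,v)=0$ for all $w\in W$, $v\in V$ is the zero subspace. A nonsingular quadratic form on a space of even dimension $2\ell$ is elliptic if it is equivalent (under an invertible linear change of variables) to $p(x_1,x_2)+x_3x_4+\cdots+x_{2\ell-1}x_{2\ell}$ with $p$ an irreducible quadratic form in two indeterminates. The Cayley graph generated by $D\subseteq V\setminus\{0\}$ has vertex set $V$, with $x,y$ adjacent if and only if $x-y\in D$. Association schemes. A (symmetric) association scheme with $n$ classes on a finite set $X$ is a partition of $X\times X$ into sets (relations) $R_0,R_1,\dots,R_n$ such that $R_0=\{(x,x): x\in X\}$, each $R_i$ with $1\le i\le n$ is symmetric, and for all $i,j,k\in\{0,1,\dots,n\}$ there is an integer $p_{ij}^k$ with $|\{z\in X:(x,z)\in R_i,\ (z,y)\in R_j\}|=p_{ij}^k$ for all $(x,y)\in R_k$. Graphs $G_1,\dots,G_n$ with vertex set $X$ form an association scheme on $X$ if the diagonal relation together with their adjacency relations is an association scheme with $n$ classes. A fusion is obtained by taking unions of classes among $R_1,\dots,R_n$ (that is, by merging them according to a partition of $\{1,\dots,n\}$); the scheme is amorphic if every one of its fusions is also an association scheme. *)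

(* Defs.v *)
From mathcomp Require Import all_boot all_order all_fingroup all_algebra all_field.
From mathcomp Require Import mpoly.

Set Implicit Arguments.
Unset Strict Implicit.
Unset Printing Implicit Defensive.

Import GRing.Theory.
Local Open Scope ring_scope.

Section QuadraticForms.

Variable F : fieldType.

Definition polar (V : lmodType F) (Q : V -> F) (u v : V) : F :=
  Q (u + v) - Q u - Q v.

Definition quadratic_form (V : lmodType F) (Q : V -> F) : Prop :=
  [/\ forall (a : F) (v : V), Q (a *: v) = a ^+ 2 * Q v,
      forall u : V, scalar (polar Q u)
    & forall v : V, scalar (polar Q ^~ v)].

Definition nonsingular (V : vectType F) (Q : V -> F) : Prop :=
  forall W : {vspace V},
    (forall w, w \in W -> Q w = 0) ->
    (forall w v, w \in W -> polar Q w v = 0) ->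
    W = 0%VS.

Definition irreducible_mpoly n (p : {mpoly F[n]}) : Prop :=
  [/\ p != 0, p \isn't a GRing.unit
    & forall a b : {mpoly F[n]}, p = a * b ->
        (a \is a GRing.unit) || (b \is a GRing.unit)].

(* The entry of index j (counted from 0), with the junk value 0 for j >= n. *)
Definition entry n (x : 'rV[F]_n) (j : nat) : F :=
  if insub j is Some k then x 0 k else 0.

(* p(x_0, x_1) + x_2 x_3 + ... + x_(2l-2) x_(2l-1), for 0 < l. *)
Definition elliptic_normal_form l (p : {mpoly F[2]}) (x : 'rV[F]_(2 * l)) : F :=
  p.@[fun j : 'I_2 => entry x j]
  + \sum_(1 <= i < l) entry x (2 * i) * entry x (2 * i).+1.

Definition elliptic l (Q : 'rV[F]_(2 * l) -> F) : Prop :=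
  exists (p : {mpoly F[2]}) (A : 'M[F]_(2 * l)),
    [/\ p \is 2.-homog, irreducible_mpoly p, A \in unitmx
      & forall x, Q (x *m A) = elliptic_normal_form p x].

End QuadraticForms.

Definition cayley (V : finZmodType) (D : {set V}) : rel V :=
  fun x y => x - y \in D.

Section AssociationSchemes.

Variable X : finType.

(* The relations R_0, ..., R_n cover X * X and are pairwise disjoint; a relation
   is allowed to be empty. *)
Definition association_scheme n (R : 'I_n.+1 -> rel X) : Prop :=
  [/\ forall x y, exists! i, R i x y,
      forall x y, R ord0 x y = (x == y),
      forall i, ssrbool.symmetric (R i)
    & forall i j k, exists p : nat, forall x y, R k x y ->
        #|[set z | R i x z && R j z y]| = p].

Definition with_diagonal n (G : 'I_n -> rel X) (k : 'I_n.+1) : rel X :=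
  fun x y => if unlift ord0 k is Some i then G i x y else x == y.

Definition fusion n (R : 'I_n.+1 -> rel X) (P : {set {set 'I_n}})
    (k : 'I_#|P|.+1) : rel X :=
  fun x y => if unlift ord0 k is Some j
    then [exists i in (enum_val j : {set 'I_n}), R (lift ord0 i) x y]
    else R ord0 x y.

Definition amorphic n (R : 'I_n.+1 -> rel X) : Prop :=
  association_scheme R /\
  forall P : {set {set 'I_n}}, partition P [set: 'I_n] ->
    association_scheme (fusion R (P := P)).

End AssociationSchemes.

Section TraceSets.

Variables (Fq : finFieldType) (L : fieldExtType Fq).

(* L with its canonical structure of finite field, splitting over Fq. *)
Local Notation Fqm := (finvect_type L).

Variables (l : nat) (Q : 'rV[Fqm]_(2 * l) -> Fqm).

Definition Omega (K : {subfield Fqm}) : {set 'rV[Fqm]_(2 * l)} :=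
  [set x | (x != 0) && (galTrace K {:Fqm} (Q x) == 0)].

(* For subfields K_1, ..., K_d with 0 < d, and j = 0, ..., d:
   Omega_1, Omega_(j+1) \ Omega_j for 0 < j < d, and (V \ 0) \ Omega_d. *)
Definition connection_set (d : nat) (K : nat -> {subfield Fqm}) (j : 'I_d.+1) :
    {set 'rV[Fqm]_(2 * l)} :=
  if (j == 0 :> nat)%N then Omega (K 1%N)
  else if (j < d)%N then Omega (K j.+1) :\: Omega (K j)
  else [set~ 0] :\: Omega (K d).

End TraceSets.

(* Main.v *)
Require Import Defs.
From mathcomp Require Import all_boot all_order all_fingroup all_algebra all_field.
From mathcomp Require Import all_character.
From mathcomp Require Import mpoly ring.

Set Implicit Arguments.
Unset Strict Implicit.
Unset Printing Implicit Defensive.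

Import GRing.Theory Num.Theory.
Local Open Scope ring_scope.

(** Write s for the size of the large field and n = s ^ l, so that V has n ^ 2
    elements.  Fix a nontrivial additive character psi of the large field; with
    B the polar form of Q, the pairing psi (B v z) identifies V with its
    character group, so that Fourier transforms of functions on V are again
    functions on V.

    A colouring of V, with 0 alone in its colour, yields an association scheme
    as soon as the Fourier transform of every colour class is constant on the
    colour classes: a product of two such transforms is again constant on
    classes, and transforming back shows that so is the convolution of two
    classes, whose values are the intersection numbers
    ([association_scheme_of_eigenmatrix]).  Suppose moreover that away from 0
    the transform of each class S is a_S + g 1_S, with one and the same g for
    all S.  This survives every merging of classes, as the a_S just add up;
    hence the scheme is amorphic ([amorphic_of_two_valued]).

    For the sets at hand g = - n works.  Every Gauss sum of b Q with b != 0 has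
    modulus n, because B is nondegenerate, while the elliptic normal form shows
    that these s - 1 sums add up to - n (s - 1); so each of them equals - n
    ([gauss_elliptic]).  Completing the square, the transform of psi (b Q z) is
    - n psi (- Q v / b).  Let psi factor through the trace to the smallest
    subfield.  Then the indicator function of Tr_K (Q z) = 0 is the mean of
    psi (b Q z) over b in K ([sum_trace_character]), and since K is stable under
    b |-> - 1 / b the transform of this indicator function is, away from 0, a
    constant plus - n times the function itself ([fourier_quadric]).  The same
    then holds for the differences of consecutive terms of the chain
      {0}, {Q_1 = 0}, ..., {Q_d = 0}, V,
    which are the connection sets.  At v = 0 the transform gives the size of
    {Q_i = 0}, and these sizes show that consecutive terms of the chain
    differ. *)

(** * Association schemes from two-valued Fourier transforms *)

Section SelfDualColourings.

Variables (V : finZmodType) (chi : V -> V -> algC).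

(** Such a chi identifies V with its group of characters; symmetry makes the
    Fourier transform and its inverse agree up to sign and scaling. *)
Definition self_dual_pairing : Prop :=
  [/\ forall u v, chi u v = chi v u,
      forall u v w, chi u (v + w) = chi u v * chi u w
    & forall v, \sum_u chi u v = #|V|%:R *+ (v == 0)].

Definition fourier (I : finType) (c : V -> I) (i : I) (v : V) : algC :=
  \sum_(z | c z == i) chi v z.

Hypothesis chiP : self_dual_pairing.

(** Fourier inversion applied to a product of transforms, which is the transform
    of a convolution; here the convolution counts the solutions z. *)
Lemma fourier_convolution (I J : finType) (c : V -> I) (c' : V -> J) i j u :
  \sum_v fourier c i v * fourier c' j v * chi v (- u) =
  #|V|%:R * #|[set z | (c (u - z) == i) && (c' z == j)]|%:R.
Proof.
have [_ chiD ortho] := chiP.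
under eq_bigr => v _.
  rewrite /fourier big_distrl /= big_distrl /=.
  under eq_bigr => a _.
    rewrite big_distrr /= big_distrl /=.
    under eq_bigr => b _ do rewrite -!chiD.
    over.
  over.
rewrite exchange_big /=.
under eq_bigr => a _.
  rewrite exchange_big /=.
  under eq_bigr => b _ do rewrite ortho.
  over.
rewrite exchange_big /= mulr_natr -[RHS]sumr_const.
rewrite [RHS](eq_bigl (fun b => (c' b == j) && (c (u - b) == i))); last first.
  by move=> b; rewrite inE andbC.
rewrite [RHS]big_mkcondr /=; apply: eq_bigr => b _.
have split_u a : (a + b - u == 0) = (a == u - b).
  by rewrite subr_eq0 eq_sym -subr_eq eq_sym.
under eq_bigr => a _ do rewrite split_u.
rewrite big_mkcond (bigD1 (u - b)) //= big1 => [|a /negbTE->]; last first.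
  by rewrite mulr0n if_same.
by rewrite eqxx addr0 mulr1n.
Qed.

(** By [fourier_convolution] an intersection number is, up to the factor #|V|,
    a sum over the colours k' of a constant times the transform of the class k'
    at x - y, which depends only on the colour of x - y.  The matrix E plays the
    part of the eigenmatrix of the scheme. *)
Lemma association_scheme_of_eigenmatrix n (c : V -> 'I_n.+1)
    (R : 'I_n.+1 -> rel V) (E : 'I_n.+1 -> 'I_n.+1 -> algC) :
  (forall k x y, R k x y = (c (x - y) == k)) ->
  (forall v, (c v == ord0) = (v == 0)) ->
  (forall v, c (- v) = c v) ->
  (forall i v, fourier c i v = E i (c v)) ->
  association_scheme R.
Proof.
move=> RE c0 cN cE; have [chiC chiD _] := chiP.
split=> [x y | x y | k x y | i j k].
- exists (c (x - y)); split; first by rewrite RE.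
  by move=> i; rewrite RE => /eqP.
- by rewrite RE c0 subr_eq0.
- by rewrite !RE -cN opprB.
pose N (u : V) := #|[set z | (c (u - z) == i) && (c z == j)]|.
have cardN x y : #|[set z | R i x z && R j z y]| = N (x - y).
  rewrite /N -[RHS](card_imset _ (addIr y)); apply: eq_card => z.
  rewrite inE !RE; apply/idP/imsetP => [h | [w]].
    exists (z - y); last by rewrite subrK.
    by rewrite inE opprB addrA subrK.
  by rewrite inE => h ->; rewrite addrK opprD addrA addrAC.
have N_class u u' : c u = c u' -> N u = N u'.
  move=> cuu'.
  have V_neq0 : #|V|%:R != 0 :> algC.
    by rewrite pnatr_eq0 -lt0n; apply/card_gt0P; exists 0.
  apply/eqP; rewrite -(eqr_nat algC); apply/eqP/(mulfI V_neq0).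
  rewrite -!fourier_convolution.
  suff NE w : \sum_v fourier c i v * fourier c j v * chi v (- w)
      = \sum_k' E i k' * E j k' * E k' (c w) by rewrite !NE cuu'.
  rewrite (partition_big c predT) //=; apply: eq_bigr => k' _.
  rewrite -[c w]cN -cE {3}/fourier mulr_sumr; apply: eq_bigr => v /eqP cv.
  by rewrite !cE cv (chiC v).
(* When the class k is empty any number serves as intersection number. *)
case: (pickP [pred xy : V * V | R k xy.1 xy.2]) => [[x0 y0] /= | noxy].
  rewrite RE => /eqP ck; exists (N (x0 - y0)) => x y; rewrite RE => /eqP ck'.
  by rewrite cardN; apply: N_class; rewrite ck ck'.
by exists 0%N => x y Rxy; have := noxy (x, y); rewrite /= Rxy.
Qed.

Lemma fourier_comp (I J : finType) (c : V -> I) (f : I -> J) j v :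
  fourier (f \o c) j v = \sum_(i | f i == j) fourier c i v.
Proof.
rewrite /fourier (partition_big c (fun i => f i == j)) //=.
apply: eq_bigr => i /eqP fi; apply: eq_bigl => z.
by apply: andb_idl => /eqP ->; apply/eqP.
Qed.

Section TwoValued.

Variables (n : nat) (c : V -> 'I_n.+1) (a : 'I_n.+1 -> algC) (g : algC).
Hypothesis c0 : forall v, (c v == ord0) = (v == 0).
Hypothesis cN : forall v, c (- v) = c v.
(* The coefficient g is common to all the classes: this is what makes the
   condition stable under fusion. *)
Hypothesis c2 : forall i v, v != 0 -> fourier c i v = a i + g *+ (c v == i).

(** The colouring f \o c merges the classes of c; the transform of a merged
    class is the sum of the transforms of its parts, so it has the same shape
    with the same g. *)
Lemma association_scheme_of_two_valued n' (f : 'I_n.+1 -> 'I_n'.+1)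
    (R : 'I_n'.+1 -> rel V) :
  (forall k, (f k == ord0) = (k == ord0)) ->
  (forall k x y, R k x y = (f (c (x - y)) == k)) ->
  association_scheme R.
Proof.
move=> f0 RE.
pose E i k := if k == ord0 then fourier (f \o c) i 0
              else (\sum_(i' | f i' == i) a i') + g *+ (k == i).
apply: (@association_scheme_of_eigenmatrix _ (f \o c) R E) => //.
- by move=> v; rewrite /= f0 c0.
- by move=> v; rewrite /= cN.
move=> i v; rewrite /E /= f0 c0; case: eqP => [-> // | /eqP v_neq0].
rewrite fourier_comp (eq_bigr _ (fun i' _ => c2 i' v_neq0)).
rewrite big_split /=; congr (_ + _).
have [fi | fi] := boolP (f (c v) == i).
  rewrite (bigD1 (c v)) //= eqxx big1 ?addr0 // => i' /andP[_].
  by rewrite eq_sym => /negbTE ->.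
rewrite big1 // => i' /eqP fi'.
by rewrite (negbTE (contraNneq _ fi)) // => ->; apply/eqP.
Qed.

Lemma amorphic_of_two_valued (R : 'I_n.+1 -> rel V) :
  (forall k x y, R k x y = (c (x - y) == k)) -> amorphic R.
Proof.
move=> RE; split; first exact: (@association_scheme_of_two_valued _ id).
move=> P partP.
have coverP k : pblock P k \in P.
  by rewrite pblock_mem // (cover_partition partP).
pose f (k : 'I_n.+1) : 'I_#|P|.+1 :=
  if unlift ord0 k is Some i
  then lift ord0 (enum_rank_in (coverP i) (pblock P i))
  else ord0.
apply: (@association_scheme_of_two_valued _ f) => [k | k x y].
  rewrite /f; case: unliftP => [i -> | ->]; last by rewrite !eqxx.
  by rewrite ![lift _ _ == _]eq_sym !(negbTE (neq_lift _ _)).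
rewrite /fusion; case: (unliftP ord0 k) => [j -> | ->]; last first.
  rewrite RE /f; case: unliftP => [i -> | ->]; last by rewrite !eqxx.
  by rewrite ![lift _ _ == _]eq_sym !(negbTE (neq_lift _ _)).
have trivP : trivIset P by case/and3P: partP.
apply/existsP/eqP => [[i /andP[ij]] | ].
  rewrite RE => /eqP ->; rewrite /f liftK; congr (lift _ _).
  apply: enum_val_inj; rewrite enum_rankK_in ?coverP //.
  by apply: def_pblock => //; apply: enum_valP.
rewrite /f; case: unliftP => [i ci | _ /eqP]; last first.
  by rewrite (negbTE (neq_lift _ _)).
move/lift_inj => <-; exists i; rewrite enum_rankK_in ?coverP //.
by rewrite mem_pblock (cover_partition partP) inE RE ci /=.
Qed.

End TwoValued.

End SelfDualColourings.

(** * Chains of subsets *)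

Section Chains.

Variables (V : finZmodType) (N : nat) (W : nat -> {set V}).
Hypothesis W0 : W 0 = [set 0].
Hypothesis WN : W N = [set: V].
Hypothesis W_step : forall j, (j < N)%N -> W j \subset W j.+1.

(** The classes of [level] are the differences W k :\: W k.-1, where W 0 = {0}
    is the class 0. *)
Definition level (v : V) : 'I_N.+1 :=
  [arg min_(j < ord_max | v \in W (val j)) val j].

Lemma chain_mono i j : (i <= j <= N)%N -> W i \subset W j.
Proof.
move=> /andP[leij]; elim: j leij => [|j IHj]; first by rewrite leqn0 => /eqP ->.
rewrite leq_eqVlt => /orP[/eqP -> // | ltij] ltjN.
exact: subset_trans (IHj ltij (ltnW ltjN)) (W_step ltjN).
Qed.

Lemma mem_chain v j : (j <= N)%N -> (v \in W j) = (level v <= j)%N.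
Proof.
move=> lejN; rewrite /level; case: arg_minnP => [|i vi min_i].
  by rewrite /= WN inE.
apply/idP/idP => [vj | leij].
  exact: (min_i (Ordinal (lejN : (j < N.+1)%N))).
by apply: (subsetP (chain_mono _)) vi; rewrite leij.
Qed.

Lemma level_eq0 v : (level v == ord0) = (v == 0).
Proof. by rewrite -[RHS](in_set1 v) -W0 mem_chain // leqn0. Qed.

Lemma level_lift v (j : 'I_N) :
  (level v == lift ord0 j) = (v \in W j.+1) && (v \notin W j).
Proof.
rewrite !mem_chain ?(ltnW (ltn_ord j)) // -ltnNge -eqn_leq.
by rewrite -val_eqE.
Qed.

Hypothesis WoppE : forall j v, (- v \in W j) = (v \in W j).

Lemma levelN v : level (- v) = level v.
Proof.
have level_le u : (level (- u) <= level u)%N.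
  by rewrite -mem_chain -1?ltnS // WoppE mem_chain -1?ltnS.
by apply/val_inj/eqP; rewrite eqn_leq level_le -{1}[v]opprK level_le.
Qed.

Variables (chi : V -> V -> algC) (a : nat -> algC) (g : algC).
Hypothesis chiP : self_dual_pairing chi.
Hypothesis chiW : forall v j, v != 0 -> (j <= N)%N ->
  \sum_(z in W j) chi v z = a j + g *+ (v \in W j).

(** Taking differences along the chain keeps the coefficient g. *)
Lemma fourier_level k v : v != 0 ->
  fourier chi level k v =
  (if k == ord0 then a 0%N else a k - a k.-1) + g *+ (level v == k).
Proof.
move=> v_neq0; rewrite /fourier.
case: (unliftP ord0 k) => [j -> | ->]; last first.
  rewrite eqxx level_eq0 (negbTE v_neq0) addr0.
  rewrite (eq_bigl (mem (W 0))) => [|z]; last by rewrite /= level_eq0 W0 inE.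
  by rewrite chiW // W0 inE (negbTE v_neq0) addr0.
rewrite eq_sym (negbTE (neq_lift _ _)) lift0 /=.
have ltj := ltn_ord j; have := chiW v_neq0 ltj.
rewrite (big_setID (W j)) /= (setIidPr (W_step ltj)).
rewrite chiW ?(ltnW ltj) // => sumE.
rewrite (eq_bigl (mem (W j.+1 :\: W j))) => [|z]; last first.
  by rewrite /= level_lift inE andbC.
rewrite level_lift; apply: (addrI (a j + g *+ (v \in W j))).
rewrite sumE; have := subsetP (W_step ltj) v.
by case: (v \in W j) => [-> // | _]; case: (v \in W j.+1); rewrite /=; ring.
Qed.

Lemma amorphic_of_chain (R : 'I_N.+1 -> rel V) :
  (forall k x y, R k x y = (level (x - y) == k)) -> amorphic R.
Proof.
apply: (amorphic_of_two_valued chiP level_eq0 levelN) => k v.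
exact: fourier_level.
Qed.

End Chains.

(** * Additive characters *)

Section AdditiveCharacters.

Definition additive_character (A : zmodType) (psi : A -> algC) : Prop :=
  {morph psi : x y / x + y >-> x * y} /\ forall x, `|psi x| = 1.

(** The irreducible characters of the finite abelian group A are linear, and
    together they separate its points. *)
Lemma exists_character_neq1 (A : finZmodType) (x : A) :
  x != 0 -> exists2 psi : A -> algC, additive_character psi & psi x != 1.
Proof.
move=> x_neq0; have abA : abelian [set: A] := FinRing.zmod_abelian _.
have lin i := char_abelianP _ abA i.
have /existsP[i xi] : [exists i : Iirr [set: A], 'chi_i x != 1].
  apply: contraR x_neq0 => /existsPn chi1.
  suff : x \in \bigcap_i cfker 'chi[[set: A]]_i.
    by rewrite TI_cfker_irr => /set1P ->.
  apply/bigcapP => i _; rewrite cfkerEchar ?lin_charW // !inE lin_char1 //=.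
  by have := chi1 i; rewrite negbK.
exists 'chi_i => //; split=> [y z | y]; last by rewrite normC_lin_char ?inE.
by rewrite -[y + z]FinRing.zmodMgE lin_charM ?inE.
Qed.

(** The usual vanishing of a nontrivial character sum, for any function which a
    translation multiplies by a constant t != 1; this covers sums over a
    subgroup as well as sums of psi \o Q along the radical of Q. *)
Lemma sum_eq0_of_shift (A : finZmodType) (P : {pred A}) (f : A -> algC) a t :
  (forall b, (b + a \in P) = (b \in P)) -> (forall b, f (b + a) = t * f b) ->
  t != 1 -> \sum_(b in P) f b = 0.
Proof.
move=> Pa fa t_neq1; set S := \sum_(b in P) f b.
have : S = t * S.
  rewrite {1}/S (reindex_inj (addIr a)) mulr_sumr.
  by apply: eq_big => b; [exact: Pa | rewrite fa].
move/eqP; rewrite -subr_eq0 -{1}[S]mul1r -mulrBl mulf_eq0 subr_eq0 eq_sym.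
by rewrite (negbTE t_neq1) => /eqP.
Qed.

Variables (A : zmodType) (psi : A -> algC).
Hypothesis psiP : additive_character psi.

Lemma characterD x y : psi (x + y) = psi x * psi y.
Proof. by case: psiP => ->. Qed.

Lemma character_neq0 x : psi x != 0.
Proof. by case: psiP => _ /(_ x) npsi; rewrite -normr_gt0 npsi ltr01. Qed.

Lemma character0 : psi 0 = 1.
Proof.
by apply: (mulfI (character_neq0 0)); rewrite -characterD addr0 mulr1.
Qed.

Lemma character_sum (I : finType) (f : I -> A) :
  psi (\sum_i f i) = \prod_i psi (f i).
Proof. exact: (big_morph psi characterD character0). Qed.

Lemma character_conj x : (psi x)^* = psi (- x).
Proof.
have [_ npsi] := psiP; apply: (mulfI (character_neq0 x)).
by rewrite -normCK npsi expr1n -characterD subrr character0.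
Qed.

End AdditiveCharacters.

(** * Gauss sums of quadratic forms *)

Section QuadraticForms.

Variables (F : finFieldType) (n : nat) (Q : 'rV[F]_n -> F).
Hypothesis quadQ : quadratic_form Q.

Local Notation V := 'rV[F]_n.
Local Notation B := (polar Q).

Lemma quadD u v : Q (u + v) = Q u + Q v + B u v.
Proof. by rewrite /polar; ring. Qed.

Lemma polarC u v : B u v = B v u.
Proof. by rewrite /polar [v + u]addrC addrAC. Qed.

Lemma polar_linear u a v w : B u (a *: v + w) = a * B u v + B u w.
Proof. by case: quadQ => _ ->. Qed.

Lemma polarDr u v w : B u (v + w) = B u v + B u w.
Proof. by rewrite -{1}[v]scale1r polar_linear mul1r. Qed.

Lemma polar0r u : B u 0 = 0.
Proof. by apply: (addrI (B u 0)); rewrite -polarDr !addr0. Qed.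

Lemma polarZr a u v : B u (a *: v) = a * B u v.
Proof. by rewrite -[_ *: _]addr0 polar_linear polar0r addr0. Qed.

Lemma quadZ a v : Q (a *: v) = a ^+ 2 * Q v.
Proof. by case: quadQ. Qed.

Lemma quadN v : Q (- v) = Q v.
Proof. by rewrite -scaleN1r quadZ sqrrN expr1n mul1r. Qed.

Lemma quad0 : Q 0 = 0.
Proof. by rewrite -(scale0r 0) quadZ expr0n mul0r. Qed.

Lemma complete_square b v z :
  b != 0 -> b * Q z + B v z = b * Q (z + b^-1 *: v) - b^-1 * Q v.
Proof.
move=> b_neq0; rewrite quadD quadZ polarZr (polarC z v).
by field.
Qed.

Variable psi : F -> algC.
Hypothesis psiP : additive_character psi.

Definition gauss (b : F) : algC := \sum_z psi (b * Q z).

Lemma gauss0 : gauss 0 = #|V|%:R.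
Proof.
rewrite /gauss; under eq_bigr => z _ do rewrite mul0r (character0 psiP).
by rewrite sumr_const.
Qed.

Lemma gauss_shift b v :
  b != 0 -> \sum_z psi (b * Q z + B v z) = psi (- (b^-1 * Q v)) * gauss b.
Proof.
move=> b_neq0.
under eq_bigr => z _ do rewrite complete_square // characterD // mulrC.
by rewrite -mulr_sumr [gauss b](reindex_inj (addIr (b^-1 *: v))).
Qed.

Hypothesis psi_neq1 : exists x, psi x != 1.

Lemma character_scale_neq1 y : y != 0 -> exists a, psi (a * y) != 1.
Proof. by case: psi_neq1 => x ? y_neq0; exists (x / y); rewrite mulfVK. Qed.

Lemma sum_character : \sum_x psi x = 0.
Proof.
have [x psix] := psi_neq1.
apply: (@sum_eq0_of_shift F predT psi x) psix => // b.
by rewrite characterD // mulrC.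
Qed.

Lemma sum_character_scale y : \sum_a psi (a * y) = #|F|%:R *+ (y == 0).
Proof.
have [-> | y_neq0] := eqVneq.
  under eq_bigr => a _ do rewrite mulr0 (character0 psiP).
  by rewrite sumr_const mulr1n.
by rewrite mulr0n -[RHS]sum_character [RHS](reindex_inj (mulIf y_neq0)).
Qed.

Hypothesis nondeg : forall w, (forall v, B w v = 0) -> w = 0.

Lemma self_dual_polar : self_dual_pairing (fun u v => psi (B u v)).
Proof.
split=> [u v | u v w | v]; first by rewrite polarC.
  by rewrite polarDr characterD.
have [-> | v_neq0] := eqVneq.
  under eq_bigr => u _ do rewrite polar0r (character0 psiP).
  by rewrite sumr_const mulr1n.
have /existsP[w Bvw] : [exists w, B v w != 0].
  apply: contraR v_neq0 => /existsPn Bv0; apply/eqP/nondeg => w.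
  by apply/eqP; rewrite -[_ == _]negbK.
have [a psia] := character_scale_neq1 Bvw.
apply: (@sum_eq0_of_shift _ predT _ (a *: w)) psia => // u.
by rewrite !(polarC _ v) polarDr polarZr characterD // mulrC.
Qed.

(** The square of the modulus is the double sum of psi (b (Q x - Q y)); with
    y = x + u the sum over x is the sum of a character, which is nontrivial
    unless u = 0. *)
Lemma gauss_norm b : b != 0 -> `|gauss b| ^+ 2 = #|V|%:R.
Proof.
move=> b_neq0; have [_ _ ortho] := self_dual_polar.
rewrite normCK /gauss rmorph_sum mulr_suml.
under eq_bigr => x _.
  rewrite mulr_sumr (reindex_inj (addrI x)) /=.
  under eq_bigr => u _.
    rewrite (character_conj psiP) -characterD //.
    rewrite (_ : _ - _ = - (b * Q u) + B x (- b *: u)); last first.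
      by rewrite quadD polarZr; ring.
    rewrite characterD //.
    over.
  over.
rewrite exchange_big; under eq_bigr => u _ do rewrite -mulr_sumr ortho.
rewrite /= (bigD1 0) //= quad0 mulr0 oppr0 (character0 psiP) scaler0 eqxx mul1r.
rewrite big1 ?addr0 // => u u_neq0.
by rewrite scaler_eq0 oppr_eq0 (negbTE b_neq0) (negbTE u_neq0) mulr0.
Qed.

(** Equality in the triangle inequality: #|F|.-1 numbers of modulus r that add
    up to - r * #|F|.-1 are all equal to - r. *)
Lemma gauss_eqN (r : nat) : #|V| = (r ^ 2)%N ->
  \sum_(b | b != 0) gauss b = - (r%:R *+ #|F|.-1) ->
  forall b, b != 0 -> gauss b = - r%:R.
Proof.
move=> cardV sum_gauss.
have norm_gauss b : b != 0 -> `|gauss b| = r%:R.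
  move=> b_neq0; apply/eqP; rewrite -(@eqrXn2 _ 2) ?ler0n //.
  by rewrite gauss_norm // cardV natrX.
move=> b b_neq0; apply: oppr_inj; rewrite opprK.
apply: (normC_sum_upper (P := fun b => b != 0)
          (F := fun b => - gauss b) (G := fun=> r%:R)) => // [c c_neq0 |].
  by rewrite normrN norm_gauss.
rewrite sumrN sum_gauss opprK sumr_const; congr (_ *+ _).
by rewrite -(cardC1 (0 : F)).
Qed.

End QuadraticForms.

(** * Binary forms *)

Section BinaryForms.

Local Notation i0 := (ord0 : 'I_2).
Local Notation i1 := (ord_max : 'I_2).
Local Notation X := ('X_i0 : {mpoly _[2]}).
Local Notation Y := ('X_i1 : {mpoly _[2]}).

Lemma ord2_cases (i : 'I_2) : (i = i0) \/ (i = i1).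
Proof. by case: i => [[|[|i]] lti] //; [left | right]; apply: val_inj. Qed.

Lemma binary_form_expansion (F : fieldType) (p : {mpoly F[2]}) :
  p \is 2.-homog ->
  exists a b c : F, p = a *: (X * X) + b *: (X * Y) + c *: (Y * Y).
Proof.
move=> /dhomogP homp.
pose mX2 : 'X_{1..2} := (U_(i0) + U_(i0))%MM.
pose mXY : 'X_{1..2} := (U_(i0) + U_(i1))%MM.
pose mY2 : 'X_{1..2} := (U_(i1) + U_(i1))%MM.
exists p@_mX2, p@_mXY, p@_mY2; rewrite -!mpolyXD -/mX2 -/mXY -/mY2.
apply/mpolyP => m; rewrite !mcoeffD !mcoeffZ !mcoeffX.
have eqm (m' : 'X_{1..2}) : (m' == m) = (m' i0 == m i0) && (m' i1 == m i1).
  apply/eqP/andP => [-> // | [/eqP e0 /eqP e1]]; apply/mnmP => i.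
  by case: (ord2_cases i) => ->.
have degm : mdeg m = (m i0 + m i1)%N.
  by rewrite mdegE big_ord_recl big_ord1; congr (_ + m _)%N; apply: val_inj.
have [m_supp | m_nsupp] := boolP (m \in msupp p); last first.
  rewrite memN_msupp_eq0 //.
  have coef0 m' : p@_m' * (m' == m)%:R = 0.
    by case: eqP => [-> | _]; rewrite ?mulr0 // memN_msupp_eq0 ?mul0r.
  by rewrite !coef0 !addr0.
have deg2 : mdeg m = 2%N := homp _ m_supp; rewrite degm in deg2.
have pm m' : (m' == m) -> p@_m = p@_m' by move/eqP ->.
move: (pm mX2) (pm mXY) (pm mY2) deg2.
rewrite !eqm /mX2 /mXY /mY2 !mnmDE !mnm1E /=.
case: (m i0) => [|[|[|k]]] //= h2 h1 h0 /eqP; rewrite ?addSn ?add0n.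
- by move=> /eqP e; move: h0; rewrite e => -> //; rewrite !mulr0 mulr1 !add0r.
- move=> /eqP[e]; move: h1; rewrite e => -> //.
  by rewrite !mulr0 mulr1 addr0 add0r.
by move=> /eqP[e]; move: h2; rewrite e => -> //; rewrite !mulr0 mulr1 !addr0.
Qed.

Lemma linear_form_nonunit (F : fieldType) (a b : F) :
  (a *: X + b *: Y) \isn't a @GRing.unit {mpoly F[2]}.
Proof.
apply/negP => /divrr /(congr1 (meval (fun=> 0))) /eqP.
rewrite mevalM mevalD !mevalZ !mevalXU !mulr0 addr0 mul0r meval1.
by rewrite eq_sym oner_eq0.
Qed.

(** A nontrivial zero (u0, u1) would give the linear factor u1 X - u0 Y; the
    cofactor below is read off from the coefficients. *)
Lemma irreducible_form_anisotropic (F : fieldType) (p : {mpoly F[2]})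
    (u : 'I_2 -> F) :
  p \is 2.-homog -> irreducible_mpoly p -> p.@[u] = 0 -> forall i, u i = 0.
Proof.
move=> homp [_ _ irr]; have [a [b [c pE]]] := binary_form_expansion homp.
rewrite pE !mevalD !mevalZ !mevalM !mevalXU => pu0.
have no_factor a1 b1 a2 b2 :
    a = a1 * a2 -> b = a1 * b2 + b1 * a2 -> c = b1 * b2 -> False.
  move=> aE bE cE; have := irr (a1 *: X + b1 *: Y) (a2 *: X + b2 *: Y).
  rewrite !(negbTE (linear_form_nonunit _ _)) => no_fact.
  suff: false by []; apply: no_fact.
  by rewrite pE aE bE cE -!mul_mpolyC !(rmorphM, rmorphD) /=; ring.
have [u1 | u1] := eqVneq (u i1) 0; last first.
  case: (no_factor (u i1) (- u i0) (a / u i1)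
           ((b + u i0 * (a / u i1)) / u i1)).
  - by field.
  - by field.
  - have -> : c = - ((a * u i0 * u i0 + b * u i0 * u i1) / (u i1 * u i1)).
      apply: (mulIf (mulf_neq0 u1 u1)); apply/eqP.
      by rewrite -subr_eq0 -pu0; apply/eqP; field.
    by field.
have [u0 | u0] := eqVneq (u i0) 0.
  by move=> i; case: (ord2_cases i) => ->.
case: (no_factor 0 1 b c); rewrite ?mul0r ?mul1r ?add0r //.
apply: (mulIf (mulf_neq0 u0 u0)); rewrite mul0r -pu0 u1; ring.
Qed.

End BinaryForms.

(** * Elliptic forms *)

Section EllipticGaussSum.

Variables (F : finFieldType) (l : nat).

(** A vector of even length regarded as a family of pairs of coordinates, so
    that the normal form is a sum of terms in separate pairs of variables.  The
    default (0, 0) is never reached, since j./2 < l. *)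
Definition row_of_pairs (f : {ffun 'I_l -> F * F}) : 'rV[F]_(2 * l) :=
  \row_j (let u := if insub (j./2) is Some i then f i else (0, 0) in
          if odd j then u.2 else u.1).

Definition pairs_of_row (x : 'rV[F]_(2 * l)) : {ffun 'I_l -> F * F} :=
  [ffun i : 'I_l => (entry x (2 * i), entry x (2 * i).+1)].

Lemma entry_ord n (x : 'rV[F]_n) (j : 'I_n) : entry x j = x 0 j.
Proof. by rewrite /entry valK. Qed.

Lemma row_of_pairsK : cancel row_of_pairs pairs_of_row.
Proof.
move=> f; apply/ffunP => i; rewrite ffunE.
have lt0 : (2 * i < 2 * l)%N by rewrite ltn_mul2l ltn_ord.
have lt1 : ((2 * i).+1 < 2 * l)%N by rewrite !mul2n -doubleS leq_double ltn_ord.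
rewrite (entry_ord _ (Ordinal lt0)) (entry_ord _ (Ordinal lt1)) !mxE /=.
by rewrite !mul2n /= uphalf_double doubleK odd_double /= valK; case: (f i).
Qed.

Lemma pairs_of_rowK : cancel pairs_of_row row_of_pairs.
Proof.
move=> x; apply/rowP => j; rewrite !mxE.
have ltj : (j./2 < l)%N by rewrite ltn_half_double -mul2n ltn_ord.
rewrite insubT ffunE /= -[RHS]entry_ord; have := odd_double_half j.
by rewrite -mul2n; case: (odd j) => /= e; congr (entry x _).
Qed.

Variable p : {mpoly F[2]}.

Definition elliptic_block (i : 'I_l) (u : F * F) : F :=
  if i == 0 :> nat then p.@[fun j : 'I_2 => if j == 0 :> nat then u.1 else u.2]
  else u.1 * u.2.

Lemma elliptic_normal_formE x : (0 < l)%N ->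
  elliptic_normal_form p x = \sum_i elliptic_block i (pairs_of_row x i).
Proof.
move=> l_gt0; rewrite /elliptic_normal_form.
pose G i := if i == 0 then p.@[fun j : 'I_2 => entry x j]
            else entry x (2 * i) * entry x (2 * i).+1.
rewrite (eq_bigr (fun i : 'I_l => G i)) => [|i _]; last first.
  rewrite /elliptic_block /G ffunE /=; case: eqP => // ->.
  by apply: meval_eq => -[[|[|j]] ?].
rewrite -(big_mkord predT G) [RHS]big_ltn //; congr (_ + _).
by rewrite !big_nat; apply: eq_bigr => -[].
Qed.

Variable psi : F -> algC.
Hypothesis psiP : additive_character psi.
Hypothesis psi_neq1 : exists x, psi x != 1.

Lemma sum_hyperbolic b :
  b != 0 -> \sum_(u : F * F) psi (b * (u.1 * u.2)) = #|F|%:R.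
Proof.
move=> b_neq0.
rewrite -(pair_bigA _ (fun x y => psi (b * (x * y)))) /=.
under eq_bigr => x _.
  under eq_bigr => y _ do rewrite mulrA mulrC.
  rewrite (sum_character_scale psiP psi_neq1) mulf_eq0 (negbTE b_neq0) /=.
  over.
by rewrite (bigD1 0) //= eqxx mulr1n big1 ?addr0 // => x /negbTE ->.
Qed.

(** Summing over b first counts the zeros of P: the vector 0 contributes
    #|F| - 1, and each other vector - 1. *)
Lemma sum_anisotropic (P : F * F -> F) :
  (forall u, (P u == 0) = (u == (0, 0))) ->
  \sum_(b | b != 0) \sum_u psi (b * P u) = - (#|F|%:R *+ #|F|.-1).
Proof.
move=> P0; rewrite exchange_big /=.
have sumb u : \sum_(b | b != 0) psi (b * P u) = #|F|%:R *+ (u == (0, 0)) - 1.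
  rewrite -P0 -(sum_character_scale psiP psi_neq1) [in RHS](bigD1 0) //= mul0r.
  by rewrite (character0 psiP) addrAC subrr add0r.
under eq_bigr => u _ do rewrite sumb.
rewrite big_split /= (bigD1 (0, 0)) //= eqxx mulr1n.
rewrite big1 ?addr0; last by move=> u /negbTE ->.
rewrite sumr_const card_prod mulNrn natrM -subn1 mulrnBr.
  by rewrite opprB mulr1n mulr_natr.
by apply/card_gt0P; exists 0.
Qed.

(** The Gauss sum of the normal form is the product of those of its blocks: each
    hyperbolic block contributes #|F|, and the anisotropic block is dealt with
    by [sum_anisotropic]. *)
Lemma sum_elliptic_normal_form :
  (0 < l)%N -> p \is 2.-homog -> irreducible_mpoly p ->
  \sum_(b | b != 0)
    \sum_(x : 'rV[F]_(2 * l)) psi (b * elliptic_normal_form p x) =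
  - ((#|F| ^ l)%:R *+ #|F|.-1).
Proof.
move=> l_gt0 homp irrp; pose o := Ordinal l_gt0.
pose P (u : F * F) := p.@[fun j : 'I_2 => if j == 0 :> nat then u.1 else u.2].
have P0 u : (P u == 0) = (u == (0, 0)).
  apply/eqP/eqP => [Pu | ->].
    have u0 := irreducible_form_anisotropic homp irrp Pu.
    by have := u0 ord_max; have := u0 ord0; case: (u) => /= ? ? -> ->.
  rewrite /P (@meval_eq _ _ _ (fun=> 0)); last by move=> j; case: ifP.
  have [a [b [c ->]]] := binary_form_expansion homp.
  by rewrite !mevalD !mevalZ !mevalM !mevalXU !mulr0 !addr0.
transitivity (\sum_(b | b != 0) (\sum_u psi (b * P u)) * (#|F| ^ l.-1)%:R).
  apply: eq_bigr => b b_neq0.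
  rewrite (reindex row_of_pairs); last first.
    apply: onW_bij; exists pairs_of_row; first exact: row_of_pairsK.
    exact: pairs_of_rowK.
  under eq_bigr => f _.
    rewrite elliptic_normal_formE // row_of_pairsK mulr_sumr.
    rewrite (character_sum psiP).
    over.
  rewrite -(bigA_distr_bigA (fun i u => psi (b * elliptic_block i u))) /=.
  rewrite (bigD1 o) //=; congr (_ * _).
  rewrite (eq_bigr (fun=> #|F|%:R)); last first.
    move=> i /negbTE i_neq0; rewrite -(sum_hyperbolic b_neq0).
    apply: eq_bigr => u _.
    by rewrite /elliptic_block -(inj_eq val_inj) /= in i_neq0 *; rewrite i_neq0.
  by rewrite prodr_const natrX (cardC1 o) card_ord.
by rewrite -mulr_suml sum_anisotropic // mulNr mulrnAl -natrM -expnS prednK.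
Qed.

End EllipticGaussSum.

Section EllipticFourier.

Variables (F : finFieldType) (l : nat) (Q : 'rV[F]_(2 * l) -> F).
Hypotheses (l_gt0 : (0 < l)%N) (quadQ : quadratic_form Q).
Hypotheses (nsQ : nonsingular Q) (ellQ : elliptic Q).
Variable psi : F -> algC.
Hypotheses (psiP : additive_character psi) (psi_neq1 : exists x, psi x != 1).

Local Notation V := 'rV[F]_(2 * l).
Local Notation B := (polar Q).

Lemma sum_gauss_elliptic :
  \sum_(b | b != 0) gauss Q psi b = - ((#|F| ^ l)%:R *+ #|F|.-1).
Proof.
have [p [A [homp irrp A_unit QA]]] := ellQ.
rewrite -(sum_elliptic_normal_form psiP psi_neq1 l_gt0 homp irrp).
apply: eq_bigr => b _.
rewrite /gauss (reindex_inj (can_inj (mulmxK A_unit))) /=.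
by apply: eq_bigr => x _; rewrite QA.
Qed.

(** A vector w != 0 in the radical of B has Q w != 0, by nonsingularity; as
    B w w = 2 Q w, this takes characteristic 2.  Every field element then is a
    square, so translation by a multiple of w multiplies psi (b Q) by any
    prescribed value of psi, and all the Gauss sums vanish.  This contradicts
    [sum_gauss_elliptic]. *)
Lemma elliptic_nondegenerate w : (forall v, B w v = 0) -> w = 0.
Proof.
move=> Bw0; apply/eqP; apply/negPn/negP => w_neq0.
have Qw : Q w != 0.
  apply: contra w_neq0 => /eqP Qw0.
  suff W0 : <[w]>%VS = 0%VS by rewrite -memv0 -W0 memv_line.
  apply: nsQ => [u /vlineP[a ->] | u v /vlineP[a ->]].
    by rewrite (quadZ quadQ) Qw0 mulr0.
  by rewrite polarC (polarZr quadQ) polarC Bw0 mulr0.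
have char2 : 2%:R = 0 :> F.
  apply: (mulIf Qw); rewrite mul0r -(Bw0 w) /polar.
  by rewrite -mulr2n -scaler_nat (quadZ quadQ); ring.
have sqr_inj : injective (fun a : F => a ^+ 2).
  move=> a b /= ab; apply/eqP; rewrite -subr_eq0 -sqrf_eq0.
  rewrite sqrrB ab -mulr_natr char2 mulr0 subr0 -mulr2n -mulr_natr char2.
  by rewrite mulr0.
have [sqrt _ sqrtK] := injF_bij sqr_inj.
have gauss_eq0 b : b != 0 -> gauss Q psi b = 0.
  move=> b_neq0; have [c psic] := psi_neq1.
  (* a is chosen so that b * Q (a *: w) = c. *)
  pose a := sqrt (c / (b * Q w)).
  apply: (@sum_eq0_of_shift _ predT _ (a *: w)) psic => // z.
  rewrite -(characterD psiP) (quadD Q) (polarZr quadQ) polarC Bw0 (quadZ quadQ).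
  by rewrite sqrtK; congr psi; field; rewrite Qw.
have := sum_gauss_elliptic; rewrite (eq_bigr _ gauss_eq0) big1 //.
move/eqP; rewrite eq_sym oppr_eq0 -mulrnA pnatr_eq0 muln_eq0 expn_eq0.
have := finNzRing_gt1 F.
by case: #|F| => [|[|k]] //.
Qed.

Lemma card_elliptic_space : #|V| = ((#|F| ^ l) ^ 2)%N.
Proof. by rewrite card_mx mul1n mulnC expnM. Qed.

Lemma gauss_elliptic b : b != 0 -> gauss Q psi b = - (#|F| ^ l)%:R.
Proof.
move: b; apply: (gauss_eqN quadQ psiP psi_neq1 elliptic_nondegenerate).
  exact: card_elliptic_space.
exact: sum_gauss_elliptic.
Qed.

(* In the application K is a subfield and H is the kernel of the trace to K;
   what is needed is that H is the annihilator of K under psi (b * y), and that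
   K is stable under b |-> - b^-1. *)
Variables K H : {pred F}.
Hypotheses (K0 : 0 \in K) (K_negV : forall b, (- b^-1 \in K) = (b \in K)).
Hypothesis KH : forall y, \sum_(b in K) psi (b * y) = #|K|%:R *+ (y \in H).

(** Expand the indicator function of H through KH and complete the square.  The
    term b = 0 gives #|V| at v = 0, and for b != 0 the sum is
    - n psi (- Q v / b); as - b^-1 runs through K together with b, KH can be
    applied backwards. *)
Lemma fourier_quadric v :
  #|K|%:R * \sum_(z | Q z \in H) psi (B v z) =
  #|V|%:R *+ (v == 0) + (#|F| ^ l)%:R
  - (#|F| ^ l)%:R * #|K|%:R *+ (Q v \in H).
Proof.
set r := (#|F| ^ l)%:R.
transitivity (\sum_(b in K) \sum_z psi (b * Q z + B v z)).
  rewrite exchange_big mulr_sumr big_mkcond; apply: eq_bigr => z _ /=.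
  under [RHS]eq_bigr => b _ do rewrite characterD //.
  by rewrite -mulr_suml KH; case: (Q z \in H); rewrite ?mulr1n ?mulr0n ?mul0r.
have [_ _ ortho] := self_dual_polar quadQ psiP psi_neq1 elliptic_nondegenerate.
rewrite (bigD1 0) //= -addrA; congr (_ + _).
  by rewrite -ortho; apply: eq_bigr => z _; rewrite mul0r add0r polarC.
transitivity (\sum_(b in K | b != 0) psi (b * Q v) * (- r)).
  rewrite (reindex_inj (h := fun b => - b^-1)); last first.
    by apply: inj_comp; [exact: oppr_inj | exact: invr_inj].
  apply: eq_big => [b | b /andP[_]]; first by rewrite K_negV oppr_eq0 invr_eq0.
  rewrite oppr_eq0 invr_eq0 => b_neq0.
  rewrite gauss_shift // ?gauss_elliptic // ?oppr_eq0 ?invr_eq0 //.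
  by rewrite invrN invrK mulNr opprK.
have := KH (Q v); rewrite (bigD1 0) //= mul0r (character0 psiP) => /eqP.
rewrite addrC eq_sym -subr_eq => /eqP sumE.
by rewrite -mulr_suml -sumE mulrnAr -/r; ring.
Qed.

(** This is [fourier_quadric] at v = 0. *)
Lemma card_quadric :
  (#|K| * (#|[set z | Q z \in H]| + #|F| ^ l) = (#|F| ^ l) ^ 2 + #|F| ^ l)%N.
Proof.
apply/eqP; rewrite -(eqr_nat algC) natrM !natrD -card_elliptic_space; apply/eqP.
have := fourier_quadric 0; rewrite eqxx mulr1n quad0 //.
under eq_bigr => z _ do rewrite polarC polar0r // character0 //.
rewrite sumr_const cardsE => E0.
have H0 : 0 \in H.
  have := KH 0; under eq_bigr => b _ do rewrite mulr0 character0 //.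
  rewrite sumr_const; case: (0 \in H) => // /eqP.
  rewrite pnatr_eq0 => /eqP/card0_eq K_eq0.
  by have := K_eq0 0; rewrite K0.
by rewrite mulrDr E0 H0 mulr1n; ring.
Qed.

End EllipticFourier.

(** * Traces to subfields *)

Section Traces.

Variables (F : fieldType) (L : splittingFieldType F).
Implicit Types K k : {subfield L}.

(** The trace to k is the sum, over the right cosets of 'Gal({:L} / K) in
    'Gal({:L} / k), of the images of the trace to K under representatives. *)
Lemma galTrace_eq0_sub K k y :
  (k <= K)%VS -> galTrace K {:L} y = 0 -> galTrace k {:L} y = 0.
Proof.
move=> skK trK; have sHG := galS {:L}%AS skK.
rewrite /galTrace (set_partition_big _ (rcosets_partition sHG)) /=.
apply: big1 => A /rcosetsP[g Gg ->].
rewrite (reindex_inj (mulIg g)) /=.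
under eq_bigl => h do rewrite mem_rcoset mulgK.
under eq_bigr => h _ do rewrite galM ?memvf //.
by rewrite -rmorph_sum -/(galTrace _ _ _) trK rmorph0.
Qed.

Lemma galTraceZ K b y :
  b \in K -> galTrace K {:L} (b * y) = b * galTrace K {:L} y.
Proof.
move=> Kb; rewrite /galTrace mulr_sumr; apply: eq_bigr => g Gg.
by rewrite rmorphM /= (fixed_gal (subvf K) Gg Kb).
Qed.

Lemma galTrace_neq0 K : exists y, galTrace K {:L} y != 0.
Proof.
have [y _] := gal_independent_contra (c_ := fun=> 1)
  (group1 'Gal({:L} / K)) (oner_neq0 _).
by under eq_bigr => g _ do rewrite mul1r; exists y.
Qed.

End Traces.

Section FiniteTraces.

Variables (Fq : finFieldType) (L : fieldExtType Fq).
Local Notation M := (finvect_type L).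
Implicit Types K k : {subfield M}.

(** A subfield of order N consists of the x with x ^+ N = x. *)
Lemma subfield_sub_of_card K1 K2 a b :
  #|K1| = (#|Fq| ^ a)%N -> #|K2| = (#|Fq| ^ b)%N -> (a %| b)%N -> (K1 <= K2)%VS.
Proof.
rewrite !card_vspace => card1 card2 /dvdnP[c bE].
apply/subvP => x; rewrite !Fermat's_little_theorem card1 card2 bE => /eqP xa.
apply/eqP; elim: c {bE} => [|c IHc]; first by rewrite mul0n expr1.
by rewrite mulSn expnD exprM xa.
Qed.

Variable psi0 : M -> algC.
Hypothesis psi0P : additive_character psi0.
Variable k : {subfield M}.

Let psi x := psi0 (galTrace k {:M} x).

Lemma trace_characterP : additive_character psi.
Proof.
case: psi0P => psiD psi1; split=> [x y | x]; last exact: psi1.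
by rewrite /psi raddfD /= psiD.
Qed.

Hypothesis psi_neq1 : exists x, psi x != 1.

(** The kernel of the trace to K is the annihilator of K.  If the trace t of y
    to K is not 0, pick c with psi c != 1: the element a := (trace of c) / t of
    K is such that a * y and c have the same trace to K, hence the same trace
    to k, so psi (a * y) = psi c. *)
Lemma sum_trace_character K y : (k <= K)%VS ->
  \sum_(b in K) psi (b * y) = #|K|%:R *+ (galTrace K {:M} y == 0).
Proof.
move=> skK; have [try0 | try_neq0] := eqVneq.
  rewrite -sumr_const; apply: eq_bigr => b Kb.
  rewrite /psi (galTrace_eq0_sub skK) ?character0 //.
  by rewrite galTraceZ // try0 mulr0.
have [c psic] := psi_neq1; pose a := galTrace K {:M} c / galTrace K {:M} y.
have galK : galois K {:M} := finField_galois (subvf K).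
have Ka : a \in K by rewrite rpred_div ?mem_galTrace ?memvf.
apply: (@sum_eq0_of_shift _ _ _ a) psic => [b | b]; first by rewrite rpredDr.
rewrite mulrDl (characterD trace_characterP) mulrC; congr (_ * _).
congr psi0; apply/eqP; rewrite -subr_eq0 -raddfB; apply/eqP.
apply: (galTrace_eq0_sub skK); rewrite raddfB /= galTraceZ // /a divfK //.
exact: subrr.
Qed.

End FiniteTraces.

(** * The scheme of trace quadrics *)

Section TraceChain.

Variables (Fq : finFieldType) (L : fieldExtType Fq) (l d : nat).
Local Notation M := (finvect_type L).
Variables (Q : 'rV[M]_(2 * l) -> M) (K : nat -> {subfield M}).

Definition trace_kernel (k : {subfield M}) : {pred M} :=
  [pred y | galTrace k {:M} y == 0].

(** The terms {0} and V put at both ends of the chain of quadrics make every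
    connection set a difference of consecutive terms. *)
Definition trace_chain (j : nat) : {set 'rV[M]_(2 * l)} :=
  if j == 0 then [set 0]
  else if (j <= d)%N then [set z | Q z \in trace_kernel (K j)]
  else [set: 'rV[M]_(2 * l)].

Hypothesis d_gt0 : (0 < d)%N.
Hypothesis Q0 : Q 0 = 0.

Lemma mem_connection_set x (j : 'I_d.+1) :
  (x \in connection_set Q K j) =
  (x \in trace_chain j.+1) && (x \notin trace_chain j).
Proof.
have trQ0 i : galTrace (K i) {:M} (Q 0) == 0 by rewrite Q0 raddf0.
rewrite /connection_set /trace_chain /=; have := ltn_ord j; rewrite ltnS.
case: eqVneq => [-> _ | j_neq0 lejd]; first by rewrite d_gt0 !inE andbC.
case: ltnP => [ltjd | ledj]; rewrite ?lejd !inE; last first.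
  have -> : K d = K j by congr K; apply/eqP; rewrite eqn_leq ledj.
  by case: (eqVneq x 0) => [-> | _]; rewrite ?trQ0 ?andbT.
by case: (eqVneq x 0) => [-> | _]; rewrite ?trQ0 ?andbF //= andbC.
Qed.

Hypothesis K_step : forall i, (0 < i < d)%N -> (K i.+1 <= K i)%VS.

Lemma trace_chain_step j :
  (j < d.+1)%N -> trace_chain j \subset trace_chain j.+1.
Proof.
rewrite ltnS /trace_chain /= => lejd.
case: ltnP => [ltjd | _]; last exact: subsetT.
apply/subsetP => x; rewrite inE; case: posnP => [_ | j_gt0].
  by rewrite inE => /eqP ->; rewrite Q0 inE raddf0.
rewrite lejd !inE => /eqP trx; apply/eqP; apply: galTrace_eq0_sub trx.
by apply: K_step; rewrite j_gt0.
Qed.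

End TraceChain.

Theorem theorem4p1 (p e q m l d : nat) (mm : nat -> nat)
    (Fq : finFieldType) (L : fieldExtType Fq)
    (K : nat -> {subfield (finvect_type L)})
    (Q : 'rV[finvect_type L]_(2 * l) -> finvect_type L) :
  prime p -> (0 < e)%N -> q = (p ^ e)%N -> (0 < m)%N -> (0 < l)%N ->
  (0 < d)%N -> mm 1%N = m -> mm d = 1%N ->
  (forall i, (1 < i <= d)%N -> (mm i %| mm i.-1)%N /\ mm i <> mm i.-1) ->
  #|Fq| = q -> #|finvect_type L| = (q ^ m)%N ->
  (forall i, (1 <= i <= d)%N -> #|K i| = (q ^ mm i)%N) ->
  quadratic_form Q -> nonsingular Q -> elliptic Q ->
  [/\ forall i, (1 <= i < d)%N -> Omega Q (K i) \subset Omega Q (K i.+1),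
      amorphic (with_diagonal
        (fun j : 'I_d.+1 => cayley (connection_set Q K j)))
    & forall j : 'I_d.+1, (1 < l)%N || (0 < j)%N ->
        connection_set Q K j != set0].
Proof.
move=> _ _ _ _ l_gt0 d_gt0 mm1 mmd mm_chain cardFq cardM cardK quadQ nsQ ellQ.
pose r := (#|finvect_type L| ^ l)%N; pose W := trace_chain d Q K.
have q_gt1 : (1 < q)%N by rewrite -cardFq finNzRing_gt1.
have Q0 := quad0 quadQ.
have K_sub i j : (0 < i <= d)%N -> (0 < j <= d)%N -> (mm i %| mm j)%N ->
    (K i <= K j)%VS.
  move=> di dj.
  by apply: (subfield_sub_of_card (Fq := Fq)); rewrite cardFq cardK.
have K_step i : (0 < i < d)%N -> (K i.+1 <= K i)%VS.
  move=> /andP[i_gt0 ltid]; apply: K_sub; rewrite ?i_gt0 ?(ltnW ltid) //.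
  by have [] := mm_chain i.+1; rewrite //= ltnS i_gt0.
have Kd_sub i : (0 < i <= d)%N -> (K d <= K i)%VS.
  by move=> di; apply: K_sub; rewrite ?d_gt0 ?leqnn // mmd dvd1n.
have [c trc] := galTrace_neq0 (K d).
(* The trace to the smallest field of the chain is a function of each of the
   other traces, so that one character serves all of them. *)
have [psi0 psi0P psi0c] := exists_character_neq1 trc.
pose psi (x : finvect_type L) := psi0 (galTrace (K d) {:finvect_type L} x).
have psiP : additive_character psi := trace_characterP psi0P (K d).
have psi_neq1 : exists x, psi x != 1 by exists c.
have sum_psi i y : (0 < i <= d)%N -> \sum_(b in K i) psi (b * y) =
    #|K i|%:R *+ (y \in trace_kernel (K i)).
  by move=> di; rewrite inE; apply: sum_trace_character (Kd_sub i di).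
have KnegV i b : (- b^-1 \in K i) = (b \in K i) by rewrite rpredN rpredV.
have WE j : (0 < j <= d)%N -> W j = [set z | Q z \in trace_kernel (K j)].
  by case: j => // j /andP[_ lejd]; rewrite /W /trace_chain lejd.
have W0 : W 0 = [set 0] by [].
have Wd : W d.+1 = [set: _] by rewrite /W /trace_chain ltnn.
have W_step j : (j < d.+1)%N -> W j \subset W j.+1 by apply: trace_chain_step.
have WN j v : (- v \in W j) = (v \in W j).
  rewrite /W /trace_chain; case: ifP => _; first by rewrite !inE oppr_eq0.
  by case: ifP; rewrite !inE // (quadN quadQ).
have cardW j : (0 < j <= d)%N -> (#|K j| * (#|W j| + r) = r ^ 2 + r)%N.
  move=> dj; rewrite WE //.
  apply: (card_quadric l_gt0 quadQ nsQ ellQ psiP psi_neq1) => //.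
  - exact: mem0v.
  - by move=> y; apply: sum_psi.
split.
- move=> i /andP[i_gt0 ltid].
  apply/subsetP => x; rewrite !inE => /andP[-> /eqP trx].
  by apply/eqP; apply: galTrace_eq0_sub trx; apply: K_step; rewrite i_gt0.
  (* The whole space behaves like a quadric for a field K with one element, and
     {0} has the constant transform 1. *)
- pose a j : algC :=
    if j == 0 then 1 else if (j <= d)%N then r%:R / #|K j|%:R else r%:R.
  have chiP := self_dual_polar quadQ psiP psi_neq1
    (elliptic_nondegenerate l_gt0 quadQ nsQ ellQ psiP psi_neq1).
  apply: (amorphic_of_chain W0 Wd W_step WN chiP (a := a) (g := - r%:R)).
    move=> v j v_neq0 lejd1; rewrite /a.
    case: (posnP j) => [-> | j_gt0].
      rewrite W0 big_set1 inE (negbTE v_neq0) addr0.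
      by rewrite polar0r // character0.
    case: (leqP j d) => [lejd | ltdj]; last first.
      have -> : j = d.+1 by apply/eqP; rewrite eqn_leq lejd1.
      rewrite Wd inE mulr1n subrr; have [chiC _ ortho] := chiP.
      under eq_bigr => z _ do rewrite chiC.
      rewrite big_mkcond /=; under eq_bigr => z _ do rewrite inE.
      by rewrite ortho (negbTE v_neq0).
    have dj : (0 < j <= d)%N by rewrite j_gt0.
    have Kj_neq0 : #|K j|%:R != 0 :> algC.
      by rewrite pnatr_eq0 -lt0n; apply/card_gt0P; exists 0; apply: mem0v.
    apply: (mulfI Kj_neq0); rewrite WE //.
    under eq_bigl => z do rewrite inE.
    rewrite (fourier_quadric l_gt0 quadQ nsQ ellQ psiP psi_neq1
               (mem0v _) (KnegV j)); last first.
      by move=> y; apply: sum_psi.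
    rewrite (negbTE v_neq0) add0r -/r !inE.
    by case: (_ == 0); rewrite ?mulr1n ?mulr0n; field.
  move=> k x y; rewrite /with_diagonal; case: unliftP => [j -> | ->].
    by rewrite (level_lift Wd W_step) /cayley (mem_connection_set K d_gt0 Q0).
  by rewrite (level_eq0 W0 Wd W_step) subr_eq0.
(* An empty connection set makes two consecutive terms of the chain equal,
   against the sizes in cardW. *)
move=> j jl; apply: contraTneq isT => D0.
have r_gt0 : (0 < r)%N by rewrite expn_gt0 ltnW // finNzRing_gt1.
have eqW : W j.+1 = W j.
  apply/eqP; rewrite eqEsubset W_step ?ltn_ord // andbT.
  apply/subsetP => x xW; apply: contraTT isT => xNW.
  by have := mem_connection_set K d_gt0 Q0 x j; rewrite D0 inE -/W xW xNW.
have rr_gt0 : (0 < r ^ 2 + r)%N by rewrite addn_gt0 r_gt0 orbT.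
case: (posnP j) => [j0 | j_gt0].
  move: eqW jl; rewrite j0 orbF W0 => eqW l_gt1.
  (* Here #|W 1| = 1 forces #|K 1| = r, that is, l = 1. *)
  have := cardW 1%N; rewrite eqW cards1 d_gt0 => /(_ isT).
  rewrite cardK ?d_gt0 // mm1 -cardM add1n -mulnn -mulnSr => /eqP.
  rewrite eqn_pmul2r // -[X in X == _]expn1 eqn_exp2l ?finNzRing_gt1 //.
  by move=> /eqP l1; rewrite -l1 in l_gt1.
have := ltn_ord j; rewrite ltnS leq_eqVlt => /orP[/eqP jd | ltjd].
  have := cardW j; rewrite -eqW jd d_gt0 leqnn => /(_ isT).
  rewrite Wd cardsT card_elliptic_space -/r cardK ?d_gt0 ?leqnn // mmd expn1.
  move/eqP; rewrite -[X in _ == X]mul1n eqn_pmul2r // => /eqP q1.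
  by rewrite q1 in q_gt1.
have := cardW j; rewrite j_gt0 ltnW // => /(_ isT); rewrite -eqW.
have := cardW j.+1; rewrite ltjd => /(_ isT) <- /eqP.
rewrite eqn_pmul2r ?addn_gt0 ?r_gt0 ?orbT // !cardK ?j_gt0 ?(ltnW ltjd) //.
rewrite eqn_exp2l // => /eqP mmE.
by have [_] := mm_chain j.+1 (introT andP (conj j_gt0 ltjd)); rewrite mmE.
Qed.
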